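(* For every graph $H$ with at least one edge and every $\eta>0$ there exists an integer $n_0=n_0(H,\eta)$ such that if $n\ge n_0$ and $G$ is a graph on $n$ vertices which satisfies $$d(x)+d(y)\ge 2\left(1-\frac{1}{\chi(H)-1}+\eta\right)n$$ for all non-adjacent $x\ne y\in V(G)$, then $G$ contains a copy of $H$.
   Context: All graphs are finite and simple; $d(x)$ is the degree of $x$ in $G$. A copy of $H$ in $G$ is a (not necessarily induced) subgraph of $G$ isomorphic to $H$. *)

(* Defs.v *)
From HB Require Import structures.
From mathcomp Require Import all_boot.

Set Implicit Arguments.
Unset Strict Implicit.
Unset Printing Implicit Defensive.

Record sgraph := SGraph {
  vertex :> finType;
  adj : rel vertex;
  adj_sym : symmetric adj;
  adj_irrefl : irreflexive adj }.

Definition degree (G : sgraph) (x : G) : nat := #|[set y | adj x y]|.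

Definition proper_coloring (G : sgraph) (k : nat) (c : {ffun G -> 'I_k}) : bool :=
  [forall x, forall y, adj x y ==> (c x != c y)].

Definition colorable (G : sgraph) (k : nat) : bool :=
  [exists c : {ffun G -> 'I_k}, proper_coloring c].

Lemma colorable_ex (G : sgraph) : exists k, colorable G k.
Proof.
exists #|G|; apply/existsP; exists [ffun x => enum_rank x].
apply/forallP => x; apply/forallP => y; apply/implyP => xy.
rewrite !ffunE (inj_eq enum_rank_inj).
by apply: contraTneq xy => ->; rewrite adj_irrefl.
Qed.

Definition chromatic_number (G : sgraph) : nat := ex_minn (colorable_ex G).

Record subgraph (G : sgraph) := Subgraph {
  sub_vertices : {set G};
  sub_adj : rel G;
  sub_adj_sym : symmetric sub_adj;
  sub_adjP : forall x y, sub_adj x y ->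
    [/\ x \in sub_vertices, y \in sub_vertices & adj x y] }.

Section SubgraphAsGraph.
Variables (G : sgraph) (F : subgraph G).

Let T : finType := {x : G | x \in sub_vertices F}.

Let e : rel T := fun x y => sub_adj F (val x) (val y).

Fact subgraph_sym : symmetric e.
Proof. by move=> x y; apply: sub_adj_sym. Qed.

Fact subgraph_irrefl : irreflexive e.
Proof.
move=> x; apply/negP => /(sub_adjP (s := F)) [_ _].
by rewrite adj_irrefl.
Qed.

Definition graph_of_subgraph : sgraph := SGraph subgraph_sym subgraph_irrefl.

End SubgraphAsGraph.

Definition isomorphic (G H : sgraph) : Prop :=
  exists2 f : G -> H, bijective f & forall x y, adj (f x) (f y) = adj x y.

Definition contains_copy (G H : sgraph) : Prop :=
  exists F : subgraph G, isomorphic (graph_of_subgraph F) H.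

Lemma contains_copyP (G H : sgraph) :
  contains_copy G H <->
  exists2 f : H -> G, injective f & forall x y, adj x y -> adj (f x) (f y).
Proof.
split=> [[F [f [g fK gK] fE]] | [f f_inj f_hom]].
  exists (fun x => val (g x)) => [x y /val_inj/(can_inj gK)//|x y].
  by rewrite -{1}(gK x) -{1}(gK y) fE => /(sub_adjP (s := F)) [].
pose e : rel G :=
  [rel u v | [exists x, exists y, [&& adj x y, f x == u & f y == v]]].
have e_sym : symmetric e.
  suff eW u v : e u v -> e v u by move=> u v; apply/idP/idP; apply: eW.
  case/existsP=> x /existsP[y /and3P[xy fx fy]].
  by apply/existsP; exists y; apply/existsP; exists x; rewrite adj_sym xy fx fy.
have eP u v : e u v -> [/\ u \in f @: H, v \in f @: H & adj u v].
  case/existsP=> x /existsP[y /and3P[xy /eqP<- /eqP<-]].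
  by rewrite !imset_f // f_hom.
exists (Subgraph e_sym eP).
have fS x : f x \in f @: H by rewrite imset_f.
have fP (u : graph_of_subgraph (Subgraph e_sym eP)) : exists x, f x == val u.
  by case/imsetP: (valP u) => x _ ux; exists x; rewrite -ux.
pose h u := xchoose (fP u).
have hK u : f (h u) = val u by apply/eqP; apply: (xchooseP (fP u)).
exists h.
  exists (fun x => exist _ (f x) (fS x)) => [u|x].
    by apply: val_inj; rewrite /= hK.
  by apply: f_inj; rewrite hK.
move=> u v; apply/idP/existsP => [uv | [x /existsP[y /and3P[xy]]]].
  by exists (h u); apply/existsP; exists (h v); rewrite uv !hK !eqxx.
by rewrite -!hK !(inj_eq f_inj) => /eqP<- /eqP<-.
Qed.

(* Main.v *)
(* Two vertices of degree below (1 - 1/r + eta) n, where r = chi(H) - 1, must be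
   adjacent, so the vertices of small degree form a clique: either it has at
   least |H| vertices and contains H, or all but |H| vertices have large degree
   and the minimum-degree form of the Erdos-Stone theorem applies. For the
   latter, a complete k-partite graph with parts of size T and k <= r grows to
   k + 1 parts of size t: counting non-adjacent pairs shows that a positive
   proportion of the vertices have t neighbours in every part, and more than t
   of these have the same neighbourhood in the k parts by pigeonhole. *)
Require Import Defs.
From mathcomp Require Import all_boot all_order all_algebra.
From mathcomp Require Import reals.
From mathcomp Require Import lra.
Set Implicit Arguments.
Unset Strict Implicit.
Unset Printing Implicit Defensive.
Import Order.TTheory GRing.Theory Num.Theory.
Local Open Scope ring_scope.

Lemma exists_subset_card (T : finType) (A : {set T}) (m : nat) :
  (m <= #|A|)%N -> exists2 B : {set T}, B \subset A & #|B| = m.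
Proof.
move=> mA; exists [set:: take m (enum A)].
  by apply/subsetP => x; rewrite inE => /mem_take; rewrite mem_enum.
rewrite cardsE (card_uniqP _) ?take_uniq ?enum_uniq//.
by rewrite size_takel// -cardE.
Qed.

Lemma exists_large_fiber (S T : finType) (f : S -> T) (A : {set S})
    (P : {set T}) (m : nat) :
  {in A, forall x, f x \in P} -> (m * #|P| < #|A|)%N ->
  exists y, (m < #|[set x in A | f x == y]|)%N.
Proof.
move=> fP; rewrite -[#|A|]sum1_card (partition_big f (mem P))//= => ltA.
apply/existsP; apply: contraLR ltA; rewrite negb_exists -leqNgt => /forallP small.
rewrite mulnC -sum_nat_const; apply: leq_sum => y _.
by rewrite sum1dep_card leqNgt small.
Qed.

(* Distinct parts need not be assumed disjoint: [adj] is irreflexive. *)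
Definition complete_multipartite (G : sgraph) (D : {set G}) (k t : nat)
    (B : 'I_k -> {set G}) : Prop :=
  [/\ forall i, B i \subset D, forall i, #|B i| = t &
      forall i j x y, i != j -> x \in B i -> y \in B j -> adj x y].

Lemma complete_multipartite_trim (G : sgraph) (D : {set G}) (k t : nat)
    (B : 'I_k -> {set G}) :
  (forall i, B i \subset D) -> (forall i, (t <= #|B i|)%N) ->
  (forall i j x y, i != j -> x \in B i -> y \in B j -> adj x y) ->
  exists B' : 'I_k -> {set G}, complete_multipartite D t B'.
Proof.
move=> BD tB Badj.
have ex i : exists C : {set G}, (C \subset B i) && (#|C| == t).
  by have [C CB Ct] := exists_subset_card (tB i); exists C; rewrite CB Ct eqxx.
exists (fun i => xchoose (ex i)).
have chosen i := andP (xchooseP (ex i)).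
have sub i := subsetP (proj1 (chosen i)).
split=> [i | i | i j x y ij xi yj].
- exact: subset_trans (proj1 (chosen i)) (BD i).
- exact: eqP (proj2 (chosen i)).
- exact: Badj ij (sub _ _ xi) (sub _ _ yj).
Qed.

Section Extension.
Variables (R : realFieldType) (e : R) (r k t T : nat) (G : sgraph).
Variables (D : {set G}) (B : 'I_k -> {set G}).
Hypotheses (e_gt0 : 0 < e) (e_le1 : e <= 1) (k_le_r : (k <= r)%N).
Hypothesis D_degree : {in D, forall x : G,
  (1 - r%:R^-1 + e) * #|G|%:R <= (degree x)%:R}.
Hypothesis B_multi : complete_multipartite D T B.
Hypotheses (T_gt0 : (0 < T)%N) (T_large : 2 * t%:R <= e * T%:R).

Let good : {set G} := [set v | [forall i, (t <= #|B i :&: [set y | adj v y]|)%N]].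

(* A bad vertex has at least T - t non-neighbours in some part. *)
Lemma card_bad_missing :
  (#|~: good| * (T - t) <=
   \sum_(i < k) \sum_(b in B i) (#|G| - degree b))%N.
Proof.
have [_ cardB _] := B_multi.
(* Double counting, in each part, of the pairs of a member [b] and a vertex [v] not adjacent to it,
   first by [b], then by [v]; [b] counts as a non-neighbour of itself. *)
have -> : (\sum_(i < k) \sum_(b in B i) (#|G| - degree b) =
           \sum_v \sum_(i < k) #|B i :\: [set y | adj v y]|)%N.
  rewrite exchange_big/=; apply: eq_bigr => i _.
  under [RHS]eq_bigr => v _ do rewrite -sum1_card big_mkcond/=.
  rewrite exchange_big/= [LHS]big_mkcond/=; apply: eq_bigr => b _.
  case: ifPn => bB; last first.
    by rewrite big1// => v _; rewrite !inE (negPf bB) andbF.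
  rewrite /degree -(cardsC [set y | adj b y]) addKn -sum1_card big_mkcond/=.
  by apply: eq_bigr => v _; rewrite !inE bB andbT adj_sym.
rewrite (bigID (mem good))/= -sum_nat_const.
apply: leq_trans (leq_addl _ _); rewrite big_mkcond [leqRHS]big_mkcond/=.
apply: leq_sum => v _; rewrite inE; case: ifPn => // /[!inE].
rewrite negb_forall => /existsP[i]; rewrite -ltnNge => few.
rewrite (bigD1 i)//=; apply: leq_trans (leq_addr _ _).
by rewrite cardsD cardB leq_sub2l// ltnW.
Qed.

(** Let n be the order of [G]. A vertex of a part has at most (1/r - e) n non-neighbours, so at most
    k T (1/r - e) n <= T (1 - e) n pairs are missing. Each bad vertex takes at least T - t >= T (1 -
    e/2) of them, which leaves at most (1 - e/2) n bad vertices. *)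
Lemma card_good : e / 2 * #|G|%:R <= #|good|%:R.
Proof.
have [BD cardB _] := B_multi.
(* This makes the truncated subtraction T - t exact. *)
have tT : (t <= T)%N.
  rewrite -(ler_nat R); have := T_large; have := ler0n R t; have := ler0n R T.
  have : (1 - e) * T%:R >= 0 by rewrite mulr_ge0 ?subr_ge0.
  by lra.
have sumG : #|good|%:R + #|~: good|%:R = #|G|%:R :> R by rewrite -natrD cardsC.
have n_ge0 := ler0n R #|G|; have bad_ge0 := ler0n R #|~: good|.
have missing : (#|~: good| * (T - t))%:R <= k%:R * (T%:R * ((r%:R^-1 - e) * #|G|%:R)).
  apply: (@le_trans _ _ (\sum_(i < k) \sum_(b in B i) (#|G| - degree b))%N%:R).
    by rewrite ler_nat card_bad_missing.
  rewrite natr_sum -[X in X%:R * _]card_ord mulr_natl -sumr_const.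
  apply: ler_sum => i _.
  rewrite natr_sum -(cardB i) mulr_natl -sumr_const; apply: ler_sum => b bB.
  rewrite natrB ?max_card//.
  by have := D_degree (subsetP (BD i) _ bB); lra.
have kr : k%:R * (r%:R^-1 - e) <= 1 - e.
  have [->|k_gt0] := posnP k; first by rewrite mul0r subr_ge0.
  have r_gt0 : (0 < r)%N := leq_trans k_gt0 k_le_r.
  have k1 : 1 <= k%:R :> R by rewrite ler1n.
  have : k%:R / r%:R <= 1 :> R by rewrite ler_pdivrMr ?ltr0n// mul1r ler_nat.
  by have := ler_peMl (ltW e_gt0) k1; lra.
have T0 : 0 < T%:R :> R by rewrite ltr0n.
have tTe : T%:R * (1 - e / 2) <= T%:R - t%:R.
  by have := T_large; lra.
have bad1 : #|~: good|%:R * (T%:R * (1 - e / 2)) <= T%:R * ((1 - e) * #|G|%:R).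
  apply: (@le_trans _ _ (#|~: good| * (T - t))%:R).
    by rewrite natrM ler_wpM2l// natrB.
  apply: le_trans missing _; rewrite mulrCA ler_pM2l//.
  by rewrite mulrA ler_wpM2r.
have bad2 : #|~: good|%:R * (1 - e / 2) <= (1 - e) * #|G|%:R.
  by rewrite -(ler_pM2l T0) mulrCA.
(* Since 1 - e = (1 - e/2)^2 - e^2/4, a factor 1 - e/2 can be cancelled next. *)
have : #|~: good|%:R * (1 - e / 2) <= (1 - e / 2) * #|G|%:R * (1 - e / 2).
  apply: le_trans bad2 _; rewrite mulrAC ler_wpM2r//.
  by have := sqr_ge0 e; rewrite expr2; lra.
rewrite ler_pM2r; last by have := e_le1; lra.
lra.
Qed.

(** The new part consists of good vertices of [D] with a common neighbourhood [W] in the union of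
    the old parts, and each old part is cut down to its trace on [W]. These traces have at least t
    vertices because the members of the new part are good. The bound pays t for each possible
    neighbourhood, plus the good vertices outside [D]. *)
Lemma complete_multipartite_extend :
  (t * 2 ^ (k * T) + #|~: D|)%:R < e / 2 * #|G|%:R ->
  exists B' : 'I_k.+1 -> {set G}, complete_multipartite D t B'.
Proof.
have [BD cardB Badj] := B_multi.
move=> /lt_le_trans/(_ card_good); rewrite ltr_nat => many.
pose U := \bigcup_i B i.
pose f (v : G) := U :&: [set y | adj v y].
have cardU : (#|U| <= k * T)%N.
  apply: (@leq_trans (\sum_(i < k) #|B i|)%N); last first.
    by under eq_bigr do rewrite cardB; rewrite sum_nat_const card_ord.
  rewrite /U; elim/big_ind2: _ => // [|A m A' m' Am A'm']; first by rewrite cards0.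
  by rewrite (leq_trans _ (leq_add Am A'm'))// cardsU leq_subr.
have [||W] := @exists_large_fiber _ _ f (good :&: D) (powerset U) t.
- by move=> v _; rewrite inE subsetIl.
- rewrite card_powerset -(ltn_add2r #|~: D|).
  apply: (@leq_ltn_trans (t * 2 ^ (k * T) + #|~: D|)%N).
    by rewrite leq_add2r leq_mul2l leq_exp2l// cardU orbT.
  apply: leq_trans many _; rewrite -(cardsID D good) leq_add2l.
  by rewrite subset_leq_card// setDE subsetIr.
set F := [set v in _ | _] => tF.
have FP v : v \in F -> [/\ v \in good, v \in D & f v = W].
  by rewrite 2!inE => /andP[/andP[vg vD] /eqP fv].
have [w /FP[wgood _ fw]] : exists w, w \in F.
  by apply/card_gt0P; apply: leq_ltn_trans tF.
have FWadj v x : v \in F -> x \in W -> adj v x.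
  by move=> /FP[_ _ <-]; rewrite !inE => /andP[].
apply: (@complete_multipartite_trim _ _ _ _ (fun i : 'I_k.+1 =>
  if unlift ord_max i is Some j then B j :&: W else F)).
- move=> i; case: unliftP => [j _|_].
    exact: subset_trans (subsetIl _ _) (BD j).
  by apply/subsetP => v /FP[].
- move=> i; case: unliftP => [j _|_]; last exact: ltnW.
  move: wgood; rewrite inE => /forallP/(_ j)/leq_trans; apply.
  rewrite -fw setIA subset_leq_card// setSI// subsetI subxx/=.
  exact: bigcup_sup.
- move=> i j x y; case: unliftP => [i' ->|->]; case: unliftP => [j' ->|->] ij.
  + move=> /setIP[xi _] /setIP[yj _]; apply: Badj xi yj.
    by apply: contraNneq ij => ->.
  + by move=> /setIP[_ xW] yF; rewrite adj_sym FWadj.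
  + by move=> xF /setIP[_ yW]; rewrite FWadj.
  + by rewrite eqxx in ij.
Qed.

End Extension.

(** Induction on k for all t at once, since k + 1 parts of size t are obtained from k parts of a
    larger size [T]. *)
Lemma exists_complete_multipartite (R : archiRealFieldType) (e : R) (r h k t : nat) :
  0 < e -> e <= 1 -> (k <= r.+1)%N ->
  exists n0, forall (G : sgraph) (D : {set G}),
    (n0 <= #|G|)%N -> (#|~: D| <= h)%N ->
    {in D, forall x : G, (1 - r%:R^-1 + e) * #|G|%:R <= (degree x)%:R} ->
    exists B : 'I_k -> {set G}, complete_multipartite D t B.
Proof.
move=> e0 e1; elim: k t => [|k IHk] t kr.
  exists 0%N => G D _ _ _; exists (fun _ => set0).
  by split=> [i|i|i]; case: i.
(* The successor puts [T] above 2 t / e and keeps it positive when t = 0. *)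
pose T := (Num.truncn (2 * t%:R / e)).+1.
have Tlarge : 2 * t%:R <= e * T%:R.
  by rewrite [leRHS]mulrC -ler_pdivrMr// ltW// truncnS_gt.
have [n0 n0P] := IHk T (ltnW kr).
(* From [n1] vertices on, e n / 2 exceeds the t 2^(k T) + h that the extension asks for. *)
pose n1 := (Num.truncn ((t * 2 ^ (k * T) + h)%:R / (e / 2))).+1.
exists (maxn n0 n1) => G D; rewrite geq_max => /andP[n0G n1G] Dh Ddeg.
have [B Bmulti] := n0P G D n0G Dh Ddeg.
have kr' : (k <= r)%N by [].
apply: (complete_multipartite_extend e0 e1 kr' Ddeg Bmulti) => //.
apply: (@le_lt_trans _ _ (t * 2 ^ (k * T) + h)%:R).
  by rewrite ler_nat leq_add2l.
rewrite [ltRHS]mulrC -ltr_pdivrMr ?divr_gt0//.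
by apply: lt_le_trans (truncnS_gt _) _; rewrite ler_nat.
Qed.

Lemma chromatic_number_coloring (H : sgraph) :
  exists c : H -> 'I_(chromatic_number H), forall x y, adj x y -> c x != c y.
Proof.
rewrite /chromatic_number; case: ex_minnP => m /existsP[c /forallP cP] _.
by exists c => x y xy; move/forallP/(_ y)/implyP: (cP x); apply.
Qed.

Lemma chromatic_number_gt1 (H : sgraph) :
  (exists x y : H, adj x y) -> (1 < chromatic_number H)%N.
Proof.
move=> [x [y xy]]; have [c /(_ _ _ xy)] := chromatic_number_coloring H.
move: (chromatic_number H) c => [|[|m]]// c; first by case: (c x).
by rewrite !ord1.
Qed.

Lemma contains_copy_clique (G H : sgraph) (A : {set G}) :
  (#|H| <= #|A|)%N -> {in A &, forall x y, x != y -> adj x y} ->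
  contains_copy G H.
Proof.
move=> HA clique; apply/contains_copyP.
pose f (x : H) : G := enum_val (widen_ord HA (enum_rank x)).
have f_inj : injective f.
  by move=> x y /enum_val_inj/(congr1 val)/= /ord_inj/enum_rank_inj.
exists f => // x y xy; apply: clique; rewrite ?enum_valP// (inj_eq f_inj).
by apply: contraTneq xy => ->; rewrite adj_irrefl.
Qed.

Lemma contains_copy_multipartite (G H : sgraph) (D : {set G}) (k : nat)
    (B : 'I_k -> {set G}) (c : H -> 'I_k) :
  (forall x y, adj x y -> c x != c y) ->
  complete_multipartite D #|H| B -> contains_copy G H.
Proof.
move=> cP [_ cardB Badj]; apply/contains_copyP.
(* A vertex goes to the part of its colour, at its rank in the whole of [H]; parts of size [#|H|]
   have room for every rank. *)
pose f (x : H) : G :=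
  enum_val (cast_ord (esym (cardB (c x))) (enum_rank x)).
have fB x : f x \in B (c x) by apply: enum_valP.
exists f => [x y fxy | x y xy]; last exact: Badj (cP _ _ xy) (fB x) (fB y).
have [cxy|cxy] := eqVneq (c x) (c y); last first.
  (* A common image of two colours would be adjacent to itself. *)
  by have := Badj _ _ _ _ cxy (fB x) (fB y); rewrite fxy adj_irrefl.
have : f x \in B (c x) by [].
move: fxy; rewrite /f; move: (cardB (c x)) (cardB (c y)); rewrite cxy => p q.
by move=> /enum_val_inj/(congr1 val)/= /ord_inj/enum_rank_inj.
Qed.

Theorem proposition7 (R : realType) (H : sgraph) (eta : R)
    (hH : exists x y : H, adj x y) (heta : 0 < eta) :
  exists n0 : nat, forall (n : nat) (G : sgraph),
    (n0 <= n)%N -> #|G| = n ->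
    (forall x y : G, x != y -> ~~ adj x y ->
       2 * (1 - 1 / ((chromatic_number H)%:R - 1) + eta) * n%:R
         <= (degree x)%:R + (degree y)%:R) ->
    contains_copy G H.
Proof.
have [c cP] := chromatic_number_coloring H.
have := chromatic_number_gt1 hH.
move: (chromatic_number H) c cP => [|r]// c cP _.
rewrite -[r.+1]addn1 natrD addrK div1r.
(* With [e <= 1], [k (1/r - e) <= 1 - e] holds also for [k = 0]. *)
pose e := Num.min eta 1.
have e0 : 0 < e by rewrite lt_min heta ltr01.
have e1 : e <= 1 by rewrite ge_min lexx orbT.
have e_eta : e <= eta by rewrite ge_min lexx.
(* [#|H|] is both the number of low-degree vertices tolerated and the size of the parts. *)
have [n0 n0P] := exists_complete_multipartite #|H| #|H| e0 e1 (leqnn r.+1).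
exists n0 => n G n0n Gn ore; rewrite -{}Gn in n0n ore.
pose D : {set G} := [set x | (1 - r%:R^-1 + e) * #|G|%:R <= (degree x)%:R].
have [small|/ltnW large] := leqP #|~: D| #|H|.
  have [|B] := n0P G D n0n small; first by move=> x; rewrite inE.
  exact: contains_copy_multipartite cP.
apply: (contains_copy_clique large) => x y; rewrite !inE -!ltNge => xD yD xy.
apply: contraTT isT => /(ore _ _ xy).
have : e * #|G|%:R <= eta * #|G|%:R by rewrite ler_wpM2r.
lra.
Qed.
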